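(* The structure $(\mathbb{N},+,\cdot,<,0,1)$ is an $\mathcal{F}$-elementary substructure of $(\mathbb{R},+,\cdot,<,0,1)$; that is, for every formula $\phi(x_1,\dots,x_m)$ in $\mathcal{F}$ with free variables among $x_1,\dots,x_m$ and all $n_1,\dots,n_m\in\mathbb{N}$, $$(\mathbb{N},+,\cdot,<,0,1)\models\phi(n_1,\dots,n_m)\quad\text{if and only if}\quad(\mathbb{R},+,\cdot,<,0,1)\models\phi(n_1,\dots,n_m).$$
   Context: Let $\mathcal{L}=\{+,\cdot,<,0,1\}$ be the language of ordered rings (first-order logic with equality), and let $\mathbb{N}=\{0,1,2,\dots\}$. Let $Q$ be a new quantifier symbol. If $\mathcal{M}=(M,<,\dots)$ is a linearly ordered $\mathcal{L}$-structure, then $\mathcal{M}\models Qx\,\phi$ is defined to mean $\mathcal{M}\models\exists z\,\forall x>z\ \phi$ (with $z$ a variable not occurring in $\phi$), i.e. ''$\phi$ holds for all sufficiently large $x$''; $\phi$ may have other free variables, interpreted as parameters. $\mathcal{F}$ is the smallest collection of $\mathcal{L}$-formulas containing all quantifier-free formulas and closed under propositional connectives and under the quantifier $Q$ (i.e. if $\phi\in\mathcal{F}$ then $Qx\,\phi\in\mathcal{F}$ for each variable $x$). *)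

(* Defs.v *)
From HB Require Import structures.
From mathcomp Require Import all_boot all_order all_algebra.
From mathcomp Require Import reals.

Set Implicit Arguments.
Unset Strict Implicit.
Unset Printing Implicit Defensive.

Import Order.TTheory GRing.Theory Num.Theory.

(* Linearly ordered structures for the language {+, *, <, 0, 1}. *)
Record ordStructure := OrdStructure {
  carrier :> Type;
  sadd : carrier -> carrier -> carrier;
  smul : carrier -> carrier -> carrier;
  slt : carrier -> carrier -> Prop;
  szero : carrier;
  sone : carrier;
  slt_irr : forall a, ~ slt a a;
  slt_trans : forall a b c, slt a b -> slt b c -> slt a c;
  slt_total : forall a b, slt a b \/ a = b \/ slt b a
}.

(* Variables are named by natural numbers. *)
Inductive term : Type :=
  | Var of nat
  | Zero
  | One
  | Add of term & term
  | Mul of term & term.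

Inductive formula : Type :=
  | Eq of term & term
  | Lt of term & term
  | Not of formula
  | And of formula & formula
  | Or of formula & formula
  | Imp of formula & formula
  | Iff of formula & formula
  | Exists of nat & formula
  | Forall of nat & formula
  | Q of nat & formula.

Fixpoint term_vars (t : term) : seq nat :=
  match t with
  | Var x => [:: x]
  | Zero | One => [::]
  | Add t1 t2 | Mul t1 t2 => term_vars t1 ++ term_vars t2
  end.

Fixpoint free_vars (phi : formula) : seq nat :=
  match phi with
  | Eq t1 t2 | Lt t1 t2 => term_vars t1 ++ term_vars t2
  | Not f => free_vars f
  | And f g | Or f g | Imp f g | Iff f g => free_vars f ++ free_vars g
  | Exists x f | Forall x f | Q x f => [seq y <- free_vars f | y != x]
  end.

Fixpoint quantifier_free (phi : formula) : bool :=
  match phi with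
  | Eq _ _ | Lt _ _ => true
  | Not f => quantifier_free f
  | And f g | Or f g | Imp f g | Iff f g =>
      quantifier_free f && quantifier_free g
  | Exists _ _ | Forall _ _ | Q _ _ => false
  end.

Inductive inF : formula -> Prop :=
  | inF_qf phi : quantifier_free phi -> inF phi
  | inF_Not f : inF f -> inF (Not f)
  | inF_And f g : inF f -> inF g -> inF (And f g)
  | inF_Or f g : inF f -> inF g -> inF (Or f g)
  | inF_Imp f g : inF f -> inF g -> inF (Imp f g)
  | inF_Iff f g : inF f -> inF g -> inF (Iff f g)
  | inF_Q x f : inF f -> inF (Q x f).

Section Semantics.

Variable M : ordStructure.

Definition upd (e : nat -> M) (x : nat) (a : M) : nat -> M :=
  fun y => if y == x then a else e y.

Fixpoint eval (e : nat -> M) (t : term) : M :=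
  match t with
  | Var x => e x
  | Zero => szero M
  | One => sone M
  | Add t1 t2 => sadd (eval e t1) (eval e t2)
  | Mul t1 t2 => smul (eval e t1) (eval e t2)
  end.

(* In the Q clause z is bound outside the assignment, so it cannot be captured
   by a variable of f. *)
Fixpoint sat (e : nat -> M) (phi : formula) : Prop :=
  match phi with
  | Eq t1 t2 => eval e t1 = eval e t2
  | Lt t1 t2 => slt (eval e t1) (eval e t2)
  | Not f => ~ sat e f
  | And f g => sat e f /\ sat e g
  | Or f g => sat e f \/ sat e g
  | Imp f g => sat e f -> sat e g
  | Iff f g => sat e f <-> sat e g
  | Exists x f => exists a : M, sat (upd e x a) f
  | Forall x f => forall a : M, sat (upd e x a) f
  | Q x f => exists z : M, forall a : M, slt z a -> sat (upd e x a) f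
  end.

(* M |= phi(a_1, ..., a_m), where a_i is the value of the variable x_i. The
   value 0 given to the other variables is irrelevant when the free variables
   of phi are among the x_i. *)
Definition models (phi : formula) (m : nat)
    (xs : m.-tuple nat) (a : m.-tuple M) : Prop :=
  sat (fun y => nth (szero M) a (index y xs)) phi.

End Semantics.

Definition embedding (M N : ordStructure) (j : M -> N) : Prop :=
  [/\ injective j,
      forall a b, j (sadd a b) = sadd (j a) (j b),
      forall a b, j (smul a b) = smul (j a) (j b),
      forall a b, slt a b <-> slt (j a) (j b)
    & j (szero M) = szero N /\ j (sone M) = sone N].

(* M, identified with its image under j, is an F-elementary substructure of N. *)
Definition F_elementary (F : formula -> Prop) (M N : ordStructure)
    (j : M -> N) : Prop :=
  embedding j /\
  forall phi : formula, F phi ->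
  forall (m : nat) (xs : m.-tuple nat), uniq xs ->
  {subset free_vars phi <= xs} ->
  forall a : m.-tuple M,
  models phi xs a <-> models phi xs (map_tuple j a).

Section Instances.

Fact ltn_total_or (a b : nat) : (a < b)%N \/ a = b \/ (b < a)%N.
Proof. by case: (ltngtP a b) => h; [left | right; right | right; left]. Qed.

Fact ltn_irr (a : nat) : ~ (a < a)%N.
Proof. by rewrite ltnn. Qed.

Fact ltn_transP (a b c : nat) : (a < b)%N -> (b < c)%N -> (a < c)%N.
Proof. exact: ltn_trans. Qed.

Definition natStr : ordStructure :=
  @OrdStructure nat addn muln (fun a b => (a < b)%N) 0%N 1%N
    ltn_irr ltn_transP ltn_total_or.

Local Open Scope ring_scope.

Variable R : realType.

Fact ltr_irr (a : R) : ~ (a < a).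
Proof. by rewrite ltxx. Qed.

Fact ltr_transP (a b c : R) : a < b -> b < c -> a < c.
Proof. exact: lt_trans. Qed.

Fact ltr_total_or (a b : R) : a < b \/ a = b \/ b < a.
Proof. by case: (ltgtP a b) => h; [left | right; right | right; left]. Qed.

Definition realStr : ordStructure :=
  @OrdStructure R +%R *%R (fun a b => a < b) 0 1
    ltr_irr ltr_transP ltr_total_or.

Definition nat_incl : natStr -> realStr := fun n : nat => (n%:R : R).

End Instances.

(* Main.v *)
Require Import Defs.
From mathcomp Require Import all_boot all_order all_algebra.
From mathcomp Require Import boolp reals.
From mathcomp Require Import polyrcf.

(** Both structures interpret every formula of F by the same quantifier-free
    condition, a Boolean combination of inequalities p > 0 with p a polynomial in
    the free variables.  Such conditions are stable under Q: as a polynomial in x,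
    p is positive for all large x iff its leading coefficient is positive, which is
    again such a condition, in the remaining variables.  The condition thus
    obtained does not depend on whether x ranges over the reals or over the
    naturals, because the naturals are unbounded in the reals. *)

Set Implicit Arguments.
Unset Strict Implicit.
Unset Printing Implicit Defensive.

Import Order.TTheory GRing.Theory Num.Theory.
Local Open Scope ring_scope.

(** * Polynomial functions and sign conditions *)

(** Polynomials with integer coefficients, kept as functions of the assignment. Negation is added to
    the operations of the language so that differences of terms are covered. *)
Inductive polyfun (R : realType) : ((nat -> R) -> R) -> Prop :=
  | polyfun_var x : polyfun (fun e => e x)
  | polyfun0 : polyfun (fun=> 0)
  | polyfun1 : polyfun (fun=> 1)
  | polyfunN p : polyfun p -> polyfun (fun e => - p e)
  | polyfunD p q : polyfun p -> polyfun q -> polyfun (fun e => p e + q e)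
  | polyfunM p q : polyfun p -> polyfun q -> polyfun (fun e => p e * q e).

Inductive signcond (R : realType) : ((nat -> R) -> Prop) -> Prop :=
  | signcond_pos p : polyfun p -> signcond (fun e => 0 < p e)
  | signcond_not S : signcond S -> signcond (fun e => ~ S e)
  | signcond_and S T : signcond S -> signcond T -> signcond (fun e => S e /\ T e).

Section SignConditions.
Variable R : realType.
Implicit Types (e : nat -> R) (p q : (nat -> R) -> R) (S T : (nat -> R) -> Prop).

Lemma eq_polyfun p q : p =1 q -> polyfun p -> polyfun q.
Proof. by move=> /funext ->. Qed.

Lemma eq_signcond S T : (forall e, S e <-> T e) -> signcond S -> signcond T.
Proof. by move=> ST; have -> : S = T by apply: funext => e; apply: propext. Qed.

Lemma polyfun_sum n (f : nat -> (nat -> R) -> R) :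
  (forall i, polyfun (f i)) -> polyfun (fun e => \sum_(i < n) f i e).
Proof.
move=> pf; elim: n => [|n IHn].
  by apply: eq_polyfun (polyfun0 R) => e; rewrite big_ord0.
by apply: eq_polyfun (polyfunD IHn (pf n)) => e; rewrite big_ord_recr.
Qed.

Lemma signcond_or S T :
  signcond S -> signcond T -> signcond (fun e => S e \/ T e).
Proof.
move=> hS hT.
apply: eq_signcond (signcond_not (signcond_and (signcond_not hS) (signcond_not hT))).
by move=> e; rewrite -not_orE notK.
Qed.

Lemma signcond_imp S T :
  signcond S -> signcond T -> signcond (fun e => S e -> T e).
Proof.
move=> hS hT; apply: eq_signcond (signcond_or (signcond_not hS) hT) => e.
by rewrite -implyE.
Qed.

Lemma signcond_eq0 p : polyfun p -> signcond (fun e => p e = 0).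
Proof.
move=> hp.
apply: eq_signcond (signcond_and (signcond_not (signcond_pos hp))
  (signcond_not (signcond_pos (polyfunN hp)))) => e; rewrite oppr_gt0.
by split=> [[]|->]; [case: ltgtP | rewrite ltxx].
Qed.

(** * Eliminating a variable at infinity *)

(** Collecting powers of [x] leaves coefficients that are again polynomial functions. The degree can
    drop for special [e], hence a size bound [n] uniform in [e]. *)
Lemma polyfun_as_poly p x : polyfun p ->
  exists (P : (nat -> R) -> {poly R}) (n : nat),
  [/\ forall i, polyfun (fun e => (P e)`_i),
      forall e, (size (P e) <= n)%N
    & forall e a, p (@upd (realStr R) e x a) = (P e).[a] ].
Proof.
elim=> {p} [y||
  |p _ [P [n [cP sP hP]]]
  |p q _ [P [n [cP sP hP]]] _ [P' [n' [cP' sP' hP']]]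
  |p q _ [P [n [cP sP hP]]] _ [P' [n' [cP' sP' hP']]]].
- case: (eqVneq y x) => [->|/negPf yx].
    exists (fun=> 'X), 2%N; split=> [i|e|e a].
    + apply: (@eq_polyfun (fun=> (i == 1%N)%:R)) => [e|]; first by rewrite coefX.
      by case: eqP => _; [exact: polyfun1 | exact: polyfun0].
    + by rewrite size_polyX.
    + by rewrite hornerX /upd eqxx.
  exists (fun e => (e y)%:P), 1%N; split=> [i|e|e a].
  + apply: (@eq_polyfun (fun e => if i == 0%N then e y else 0)) => [e|].
      by rewrite coefC.
    by case: eqP => _; [exact: polyfun_var | exact: polyfun0].
  + exact: size_polyC_leq1.
  + by rewrite hornerC /upd yx.
- exists (fun=> 0), 0%N; split=> [i|e|e a].
  + by apply: eq_polyfun (polyfun0 R) => e; rewrite coef0.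
  + by rewrite size_poly0.
  + by rewrite horner0.
- exists (fun=> 1), 1%N; split=> [i|e|e a].
  + apply: (@eq_polyfun (fun=> (i == 0%N)%:R)) => [e|]; first by rewrite coef1.
    by case: eqP => _; [exact: polyfun1 | exact: polyfun0].
  + by rewrite size_poly1.
  + by rewrite hornerC.
- exists (fun e => - P e), n; split=> [i|e|e a].
  + by apply: eq_polyfun (polyfunN (cP i)) => e; rewrite coefN.
  + by rewrite size_polyN.
  + by rewrite hornerN hP.
- exists (fun e => P e + P' e), (maxn n n'); split=> [i|e|e a].
  + by apply: eq_polyfun (polyfunD (cP i) (cP' i)) => e; rewrite coefD.
  + by rewrite (leq_trans (size_polyD _ _))// geq_max !leq_max sP sP' orbT.
  + by rewrite hornerD hP hP'.
- exists (fun e => P e * P' e), (n + n')%N; split=> [i|e|e a].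
  + apply: (@eq_polyfun
      (fun e => \sum_(j < i.+1) (P e)`_j * (P' e)`_(i - j))) => [e|].
      by rewrite coefM.
    apply: (@polyfun_sum i.+1 (fun j e => (P e)`_j * (P' e)`_(i - j))) => j.
    exact: polyfunM.
  + rewrite (leq_trans (size_polyMleq _ _))// (leq_trans (leq_pred _))//.
    exact: leq_add.
  + by rewrite hornerM hP hP'.
Qed.

(** As the degree varies with [e], the leading coefficient need not be polynomial in [e]. Its sign
    is found by descending from the top index to the first nonzero coefficient. *)
Lemma signcond_lead_coef_gt0 (P : (nat -> R) -> {poly R}) (n : nat) :
  (forall i, polyfun (fun e => (P e)`_i)) -> (forall e, (size (P e) <= n)%N) ->
  signcond (fun e => 0 < lead_coef (P e)).
Proof.
move=> cP sP.
(* The size bound becomes a hypothesis on each [e]: in the induction, the smaller bound holds only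
   for some [e]. *)
have [T hT TP] : exists2 T, signcond T &
    forall e, (size (P e) <= n)%N -> (T e <-> 0 < lead_coef (P e)).
  elim: n {sP} => [|n [T hT TP]].
    exists (fun=> 0 < (0 : R)); first exact/signcond_pos/polyfun0.
    by move=> e; rewrite leqn0 size_poly_eq0 => /eqP ->; rewrite lead_coef0.
  exists (fun e => 0 < (P e)`_n \/ (P e)`_n = 0 /\ T e).
    by apply: signcond_or (signcond_and _ hT); [apply: signcond_pos
                                               | apply: signcond_eq0].
  move=> e; rewrite leq_eqVlt => /orP[/eqP sPe|]; last first.
    (* Here index [n] is out of range, so the coefficient is the default value 0 and [T] decides. *)
    rewrite ltnS => sPe; rewrite [(P e)`_n]nth_default// ltxx -TP//.
    by split=> [[|[]]|]; last right.
  have Pn : (P e)`_n = lead_coef (P e) by rewrite lead_coefE sPe.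
  have Pn0 : (P e)`_n != 0 by rewrite Pn lead_coef_eq0 -size_poly_eq0 sPe.
  by rewrite -Pn; split=> [[//|[/eqP]]|]; [rewrite (negPf Pn0) | left].
by apply: eq_signcond hT => e; apply: TP.
Qed.

(** A polynomial with positive leading coefficient is eventually at least that coefficient; this is
    applied to [p] or to [- p], unless [p] is zero. *)
Lemma eventually_horner_gt0 (p : {poly R}) :
  exists z, forall a, z < a -> (0 < p.[a] <-> 0 < lead_coef p).
Proof.
have [p0|p0|/eqP] := ltgtP 0 (lead_coef p).
- have [z hz] := poly_pinfty_gt_lc p0; exists z => a /ltW za; split=> // _.
  exact: lt_le_trans p0 (hz a za).
- have Np0 : 0 < lead_coef (- p) by rewrite lead_coefN oppr_gt0.
  have [z hz] := poly_pinfty_gt_lc Np0; exists z => a /ltW /hz h.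
  have := lt_le_trans Np0 h; rewrite hornerN oppr_gt0 => pa.
  by split=> // /lt_gtF; rewrite pa.
- rewrite eq_sym lead_coef_eq0 => /eqP ->; exists 0 => a _.
  by rewrite horner0 ltxx.
Qed.

(** An equivalence beyond [z] makes the truth value eventually constant, which is what lets the
    induction pass through negation. *)
Lemma signcond_eventually S x : signcond S ->
  exists2 T, signcond T & forall e, exists z, forall a, z < a ->
    (S (@upd (realStr R) e x a) <-> T e).
Proof.
elim=> {S} [p hp|S _ [T hT ST]|S S' _ [T hT ST] _ [T' hT' ST']].
- have [P [n [cP sP hP]]] := polyfun_as_poly x hp.
  exists (fun e => 0 < lead_coef (P e)); first exact: signcond_lead_coef_gt0 sP.
  move=> e; have [z hz] := eventually_horner_gt0 (P e).
  by exists z => a /hz; rewrite hP.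
- exists (fun e => ~ T e); first exact: signcond_not.
  by move=> e; have [z hz] := ST e; exists z => a /hz; tauto.
- exists (fun e => T e /\ T' e); first exact: signcond_and.
  move=> e; have [z hz] := ST e; have [z' hz'] := ST' e.
  by exists (Num.max z z') => a; rewrite gt_max => /andP[/hz + /hz']; tauto.
Qed.

Lemma polyfun_eval t : polyfun (fun e => @eval (realStr R) e t).
Proof.
elim: t => [x|||t1 h1 t2 h2|t1 h1 t2 h2] /=.
- exact: polyfun_var.
- exact: polyfun0.
- exact: polyfun1.
- exact: polyfunD h1 h2.
- exact: polyfunM h1 h2.
Qed.

End SignConditions.

(** * Expressing formulas by sign conditions *)

Lemma embedding_eval (M N : ordStructure) (j : M -> N) e t :
  embedding j -> j (eval e t) = eval (j \o e) t.
Proof.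
by case=> _ jD jM _ [j0 j1]; elim: t => //= t1 <- t2 <-; rewrite (jD, jM).
Qed.

Lemma comp_upd (M N : ordStructure) (j : M -> N) e x a :
  j \o upd e x a = upd (j \o e) x (j a).
Proof. by apply: funext => y /=; rewrite /upd; case: eqP. Qed.

(* One condition serves every substructure M that is unbounded in the reals. *)
Definition expresses (R : realType) (S : (nat -> R) -> Prop) (phi : formula) :=
  forall (M : ordStructure) (j : M -> realStr R), embedding j ->
    (forall r : R, exists m, r < j m) -> forall e, sat e phi <-> S (j \o e).

(** Shared by the inductions on quantifier-free formulas and on [inF]. *)
Lemma expressible_connectives (R : realType)
    (E := fun phi => exists2 S, signcond S & expresses (R := R) S phi) :
  (forall f, E f -> E (Not f)) /\
  (forall f g, E f -> E g ->
    [/\ E (And f g), E (Or f g), E (Imp f g) & E (Iff f g)]).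
Proof.
split=> [f [S hS fS]|f g [S hS fS] [T hT gT]].
  exists (fun e => ~ S e); first exact: signcond_not.
  by move=> M j je jc e /=; rewrite (propext (fS M j je jc e)).
have fgE (M : ordStructure) (j : M -> realStr R) (je : embedding j)
    (jc : forall r : R, exists m, r < j m) e :=
  (propext (fS M j je jc e), propext (gT M j je jc e)).
split.
- exists (fun e => S e /\ T e); first exact: signcond_and.
  by move=> M j je jc e /=; rewrite !(fgE M j je jc e).
- exists (fun e => S e \/ T e); first exact: signcond_or.
  by move=> M j je jc e /=; rewrite !(fgE M j je jc e).
- exists (fun e => S e -> T e); first exact: signcond_imp.
  by move=> M j je jc e /=; rewrite !(fgE M j je jc e).
- exists (fun e => S e <-> T e).
    by apply: signcond_and; apply: signcond_imp.
  by move=> M j je jc e /=; rewrite !(fgE M j je jc e).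
Qed.

Lemma expressible_qf (R : realType) (phi : formula) : quantifier_free phi ->
  exists2 S, signcond S & expresses (R := R) S phi.
Proof.
have [ENot ECon] := expressible_connectives R.
elim: phi => //= [t1 t2 _|t1 t2 _|f IHf /IHf|f IHf g IHg /andP[/IHf hf /IHg hg]
  |f IHf g IHg /andP[/IHf hf /IHg hg]|f IHf g IHg /andP[/IHf hf /IHg hg]
  |f IHf g IHg /andP[/IHf hf /IHg hg]]; last 4 first.
- by have [] := ECon _ _ hf hg.
- by have [] := ECon _ _ hf hg.
- by have [] := ECon _ _ hf hg.
- by have [] := ECon _ _ hf hg.
(* An equation between terms says that their difference vanishes; injectivity of [j] reflects it
   back to [M]. *)
- have hp := polyfunD (polyfun_eval R t1) (polyfunN (polyfun_eval R t2)).
  eexists; first exact: signcond_eq0 hp.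
  move=> M j je _ e /=; rewrite -!(embedding_eval _ _ je).
  have [jinj _ _ _ _] := je.
  by split=> [->|/eqP]; [rewrite subrr | rewrite subr_eq0 => /eqP /jinj].
- have hp := polyfunD (polyfun_eval R t2) (polyfunN (polyfun_eval R t1)).
  eexists; first exact: signcond_pos hp.
  move=> M j je _ e /=; rewrite -!(embedding_eval _ _ je) subr_gt0.
  by have [_ _ _ jlt _] := je; apply: jlt.
- exact: ENot.
Qed.

Lemma expressible_inF (R : realType) (phi : formula) : inF phi ->
  exists2 S, signcond S & expresses (R := R) S phi.
Proof.
have [ENot ECon] := expressible_connectives R.
elim=> {phi} [phi|f _ /ENot //|f g _ hf _ hg|f g _ hf _ hg|f g _ hf _ hg
  |f g _ hf _ hg|x f _ [S hS fS]]; first exact: expressible_qf.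
- by have [] := ECon _ _ hf hg.
- by have [] := ECon _ _ hf hg.
- by have [] := ECon _ _ hf hg.
- by have [] := ECon _ _ hf hg.
have [T hT ST] := signcond_eventually x hS; exists T => // M j je jc e /=.
have [r hr] := ST (j \o e); have [_ _ _ jlt _] := je.
have {}hr a : r < j a -> sat (upd e x a) f <-> T (j \o e).
  by move=> /hr; rewrite -comp_upd -(fS M j je jc).
split=> [[z hz]|Te].
  (* Beyond [r] the truth value is constant, so a single point of [M] past both [r] and [j z]
     determines [T]. *)
  have [a] := jc (Num.max r (j z)); rewrite gt_max => /andP[ra za].
  by apply/(hr a ra)/hz/jlt.
(* The threshold [r] is real; unboundedness supplies one inside [M]. *)
have [z rz] := jc r; exists z => a /jlt za.
by apply/hr => //; apply: lt_trans rz za.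
Qed.

(** Variables outside [xs] take the default value zero, which [j] preserves, so the two assignments
    agree everywhere. *)
Lemma models_sat_comp (M N : ordStructure) (j : M -> N) phi m
    (xs : m.-tuple nat) (a : m.-tuple M) : j (szero M) = szero N ->
  models phi xs (map_tuple j a) =
  sat (j \o (fun y => nth (szero M) a (index y xs))) phi.
Proof.
move=> j0; congr sat; apply: funext => y /=; rewrite -j0.
have [lt_a|ge_a] := ltnP (index y xs) (size a); first exact: nth_map.
by rewrite !nth_default ?size_map.
Qed.

Lemma nat_incl_embedding (R : realType) : embedding (nat_incl R).
Proof.
split=> [a b /eqP|a b|a b|a b|//].
- by rewrite eqr_nat => /eqP.
- exact: natrD.
- exact: natrM.
- by rewrite /= ltr_nat.
Qed.

Theorem theorem2p1 (R : realType) : F_elementary inF (nat_incl R).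
Proof.
have jN := nat_incl_embedding R; split=> // phi Fphi m xs _ _ a.
have [S _ phiS] := expressible_inF R Fphi.
rewrite models_sat_comp; last by case: jN => _ _ _ _ [].
rewrite /models (phiS _ _ jN); last first.
  (* The naturals are unbounded by the Archimedean property. *)
  by move=> r; exists (Num.truncn r).+1; apply: truncnS_gt.
(* The same [S] is now used for the reals, embedded in themselves by the identity. *)
rewrite (phiS _ id) //; last by move=> r; exists (r + 1); rewrite ltrDl.
by split.
Qed.
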